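(* For every integer $n\geq 3$, the $(n-1)$-th Lucas number $\ell_{n-1}$ equals the number of perfect matchings of the Cartesian product graph $P_2\times T_n$.
   Context: $P_2$ is the path with two vertices. $T_n$ is the caterpillar with vertex set $\{1,\dots,n\}$ and edges $\{1,3\}$, $\{2,3\}$, and $\{i,i+1\}$ for $3\leq i\leq n-1$ (a path $2,3,4,\dots,n$ with an extra pendant vertex $1$ attached to vertex $3$). $P_2\times T_n$ is the Cartesian product of graphs. Lucas numbers: $\ell_1=1,\ell_2=3$, $\ell_k=\ell_{k-1}+\ell_{k-2}$. *)

(* Defs.v *)
From mathcomp Require Import all_boot.

Set Implicit Arguments.
Unset Strict Implicit.
Unset Printing Implicit Defensive.

Record sgraph := SGraph {
  vertex :> finType;
  adj : rel vertex;
  adj_sym : symmetric adj;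
  adj_irrefl : irreflexive adj }.

Definition edges (G : sgraph) : {set {set G}} :=
  [set e : {set G} | [exists x : G, exists y : G, adj x y && (e == [set x; y])]].

Definition perfect_matching (G : sgraph) (M : {set {set G}}) : bool :=
  (M \subset edges G) && [forall v : G, #|[set e in M | v \in e]| == 1].

Definition num_perfect_matchings (G : sgraph) : nat :=
  #|[set M : {set {set G}} | perfect_matching M]|.

Section CartesianProduct.
Variables G H : sgraph.

Definition cart_adj : rel (G * H)%type := fun p q =>
  (p.1 == q.1) && adj p.2 q.2 || (p.2 == q.2) && adj p.1 q.1.

Lemma cart_adj_sym : symmetric cart_adj.
Proof.
move=> [a b] [c d]; rewrite /cart_adj /=.
by rewrite eq_sym (eq_sym b) (adj_sym b) (adj_sym a).
Qed.

Lemma cart_adj_irrefl : irreflexive cart_adj.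
Proof. by move=> [a b]; rewrite /cart_adj /= !adj_irrefl !andbF. Qed.

Definition cart_prod : sgraph := SGraph cart_adj_sym cart_adj_irrefl.

End CartesianProduct.

Section PathGraph.
Variable n : nat.

Definition path_adj : rel 'I_n := fun i j => (i.+1 == j) || (j.+1 == i).

Lemma path_adj_sym : symmetric path_adj.
Proof. by move=> i j; rewrite /path_adj orbC. Qed.

Lemma path_adj_irrefl : irreflexive path_adj.
Proof. by move=> i; rewrite /path_adj gtn_eqF. Qed.

Definition path_graph : sgraph := SGraph path_adj_sym path_adj_irrefl.

End PathGraph.

(* The edges {a, b}, a < b, of the caterpillar in terms of the labels 1, 2, ... *)
Definition caterpillar_edge (a b : nat) : bool :=
  [|| (a == 1) && (b == 3), (a == 2) && (b == 3) | (3 <= a) && (b == a.+1)].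

Section Caterpillar.
Variable n : nat.

(* The ordinal i : 'I_n stands for the vertex with label i.+1 in {1, ..., n}. *)
Definition caterpillar_adj : rel 'I_n := fun i j =>
  caterpillar_edge i.+1 j.+1 || caterpillar_edge j.+1 i.+1.

Lemma caterpillar_adj_sym : symmetric caterpillar_adj.
Proof. by move=> i j; rewrite /caterpillar_adj orbC. Qed.

Lemma caterpillar_adj_irrefl : irreflexive caterpillar_adj.
Proof.
move=> i; rewrite /caterpillar_adj orbb /caterpillar_edge.
by case: i => [[|[|m]] im] //=; rewrite ltn_eqF ?andbF.
Qed.

Definition caterpillar : sgraph :=
  SGraph caterpillar_adj_sym caterpillar_adj_irrefl.

End Caterpillar.

(* The value 2 at index 0 is the one forced by the recurrence from the values
   1 and 3 at indices 1 and 2. *)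
Fixpoint lucas (k : nat) : nat :=
  match k with
  | 0 => 2
  | 1 => 1
  | (k'.+1 as k1).+1 => lucas k1 + lucas k'
  end.

(* Main.v *)
Require Import Defs.
From mathcomp Require Import all_boot.

(** Let [v] be a leaf of [T] with neighbour [w].  A perfect matching of [P_2 x T]
    either matches the two copies of [v] with each other, or matches each of them
    with the copy of [w] in its own layer.  Hence
    [N (T) = N (T - v) + N (T - v - w)].  Stripping the last vertex of the
    caterpillar gives the Lucas recurrence, and the vertices 1, 2, 3 give the
    initial values. *)

Set Implicit Arguments.
Unset Strict Implicit.
Unset Printing Implicit Defensive.

(** * Perfect matchings of induced subgraphs *)

Section MatchingsOfSubset.
Variable G : sgraph.
Implicit Types (A : {set G}) (M : {set {set G}}).

(** The boolean [v \in A] is read as a number: a vertex of [A] is covered once, any other vertex not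
    at all. So [M] is a perfect matching of the subgraph induced on [A], but keeps its type when
    vertices are deleted. *)
Definition matching_of A M : bool :=
  (M \subset edges G) &&
  [forall v : G, #|[set e in M | v \in e]| == (v \in A)].

Definition num_matchings_of A : nat := #|[set M | matching_of A M]|.

Lemma num_matchings_ofT : num_matchings_of setT = num_perfect_matchings G.
Proof.
apply: eq_card => M; rewrite !inE; congr (_ && _).
by apply: eq_forallb => v; rewrite inE.
Qed.

Lemma edge_set2 (v w : G) : adj v w -> [set v; w] \in edges G.
Proof.
by move=> vw; rewrite inE; apply/existsP; exists v; apply/existsP; exists w;
  rewrite vw eqxx.
Qed.

Lemma edgeP (e : {set G}) (v : G) :
  e \in edges G -> v \in e -> exists2 w, adj v w & e = [set v; w].
Proof.
rewrite inE => /existsP[x /existsP[y /andP[xy /eqP->]]].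
rewrite !inE => /orP[] /eqP->; first by exists y.
by exists x; [rewrite adj_sym | rewrite setUC].
Qed.

Lemma set2_injr (v : G) : injective (fun w => [set v; w]).
Proof.
move=> w w' /setP eqS.
have := eqS w; have := eqS w'; rewrite !inE !eqxx !orbT.
by case: (eqVneq w' v) => [->|_] /=; case: (eqVneq w v) => //= _ /eqP.
Qed.

Lemma matching_of_uniq A M (v : G) e e' : matching_of A M ->
  e \in M -> e' \in M -> v \in e -> v \in e' -> e = e'.
Proof.
move=> /andP[_ /forallP/(_ v) /eqP cardM] eM e'M ve ve'.
have /card_le1_eqP : #|[set e in M | v \in e]| <= 1 by rewrite cardM leq_b1.
by apply; rewrite inE ?eM ?e'M.
Qed.

Lemma matching_of_mem A M (v : G) e :
  matching_of A M -> e \in M -> v \in e -> v \in A.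
Proof.
move=> /andP[_ /forallP/(_ v) /eqP cardM] eM ve.
by rewrite -[v \in A]lt0b -cardM; apply/card_gt0P; exists e; rewrite inE eM.
Qed.

(** Dropping the edge lowers the cover count by one at [v] and at [w] and nowhere else, which is
    exactly how the required counts change. *)
Lemma matching_ofD1 A M (v w : G) :
  v \in A -> w \in A -> adj v w -> [set v; w] \in M ->
  matching_of A M = matching_of (A :\ v :\ w) (M :\ [set v; w]).
Proof.
move=> vA wA vw eM; congr (_ && _).
  by rewrite -{1}(setD1K eM) subUset sub1set edge_set2.
apply: eq_forallb => x.
rewrite (cardsD1 [set v; w]) inE eM /=.
have -> : [set e in M | x \in e] :\ [set v; w] =
          [set e in M :\ [set v; w] | x \in e].
  by apply/setP => e; rewrite !inE andbA.
rewrite !inE.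
case: (eqVneq x v) => [->|_]; first by rewrite vA andbF.
by case: (eqVneq x w) => [->|_]; first by rewrite wA.
Qed.

Lemma num_matchings_of_through A (v w : G) : v \in A -> w \in A -> adj v w ->
  #|[set M | matching_of A M & [set v; w] \in M]| =
  num_matchings_of (A :\ v :\ w).
Proof.
move=> vA wA vw; set e := [set v; w].
have eN M : matching_of (A :\ v :\ w) M -> e \notin M.
  move=> mM; apply/negP => eM.
  by have := matching_of_mem mM eM (set22 v w); rewrite !inE eqxx.
(* Inserting [e] is injective on matchings that avoid [e], and deleting [e] inverts it. *)
rewrite /num_matchings_of -(card_in_imset (f := fun M => e |: M)
            (D := [set M | matching_of (A :\ v :\ w) M])); last first.
  move=> M1 M2; rewrite !inE => /eN e1 /eN e2 eqM.
  by rewrite -(setU1K e1) -(setU1K e2) eqM.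
apply: eq_card => M; rewrite inE; apply/andP/imsetP => [[mM eM]|[M' mM' ->]].
  by exists (M :\ e); rewrite ?setD1K // inE -matching_ofD1.
rewrite inE in mM'; rewrite setU11; split=> //.
by rewrite (matching_ofD1 vA wA) ?setU11 // setU1K ?eN.
Qed.

(** Each matching of [A] gives [v] exactly one partner, so the matchings are sorted by that
    partner. *)
Lemma num_matchings_of_expand A (v : G) : v \in A ->
  num_matchings_of A =
  \sum_(w in A | adj v w) num_matchings_of (A :\ v :\ w).
Proof.
move=> vA.
(* The default [v] is never reached for a matching of [A]: some edge of [M] covers [v], so the pick
   succeeds. *)
pose mate (M : {set {set G}}) := odflt v [pick w | [set v; w] \in M].
have mateP M w : matching_of A M -> ([set v; w] \in M) = (mate M == w).
  move=> mM; rewrite /mate; case: pickP => [u uM|noM] /=.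
    apply/idP/eqP => [wM|<- //].
    exact: set2_injr (matching_of_uniq mM uM wM (set21 v u) (set21 v w)).
  have /andP[sM /forallP/(_ v)] := mM; rewrite vA => /eqP cardM.
  have /card_gt0P[e] : 0 < #|[set e in M | v \in e]| by rewrite cardM.
  rewrite inE => /andP[eM ve].
  have [u _ eE] := edgeP (subsetP sM e eM) ve.
  by have := noM u; rewrite -eE eM.
rewrite {1}/num_matchings_of -sum1dep_card.
rewrite (partition_big mate (fun w => (w \in A) && adj v w)) /=.
  apply: eq_bigr => w /andP[wA vw].
  rewrite -num_matchings_of_through // -sum1dep_card.
  by apply: eq_bigl => M; case mM: (matching_of A M); rewrite //= mateP.
move=> M mM.
have eM : [set v; mate M] \in M by rewrite mateP.
rewrite (matching_of_mem mM eM) ?set22 //=.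
have /andP[sM _] := mM.
have [u vu /set2_injr ->] := edgeP (subsetP sM _ eM) (set21 v (mate M)).
exact: vu.
Qed.

Lemma num_matchings_of0 : num_matchings_of set0 = 1.
Proof.
rewrite -(cards1 (set0 : {set {set G}})); apply: eq_card => M; rewrite !inE.
apply/idP/eqP => [mM|->].
  apply/setP => e; rewrite inE; apply/negP => eM.
  have /andP[/subsetP/(_ e eM) ee _] := mM.
  move: (ee); rewrite inE => /existsP[x /existsP[y /andP[_ /eqP eE]]].
  by have := matching_of_mem mM eM (v := x); rewrite eE set21 inE => /(_ isT).
rewrite /matching_of sub0set; apply/forallP => v.
by rewrite inE cards_eq0; apply/eqP/setP => e; rewrite !inE.
Qed.

End MatchingsOfSubset.

(** * Prisms over induced subgraphs of a graph *)

Section Prism.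
Variable H : sgraph.
Implicit Type S : {set H}.

Let G := cart_prod (path_graph 2) H.

Definition columns S : {set G} := [set p : G | p.2 \in S].

Definition num_prism_matchings S : nat := num_matchings_of (columns S).

Lemma num_prism_matchings0 : num_prism_matchings set0 = 1.
Proof.
rewrite -(num_matchings_of0 G) /num_prism_matchings; congr num_matchings_of.
by apply/setP => p; rewrite !inE.
Qed.

Lemma num_prism_matchingsT :
  num_prism_matchings setT = num_perfect_matchings G.
Proof.
rewrite -num_matchings_ofT /num_prism_matchings; congr num_matchings_of.
by apply/setP => p; rewrite !inE.
Qed.

Let o0 : path_graph 2 := ord0.
Let o1 : path_graph 2 := ord_max.

Lemma path2P (x : path_graph 2) : x = o0 \/ x = o1.
Proof. by case: x => [[|[|//]] i]; [left|right]; apply: val_inj. Qed.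

Lemma columnsD1 S (v : H) : columns S :\ (o0, v) :\ (o1, v) = columns (S :\ v).
Proof.
apply/setP => -[x u]; rewrite !inE /= !xpair_eqE.
by case: (path2P x) => ->; case: (u == v).
Qed.

(** Within the columns over [S], the only neighbour of [(o0, v)] is [(o1, v)], so this rung is
    forced. *)
Lemma num_prism_matchings_isolated S (v : H) :
  v \in S -> (forall u, u \in S -> ~~ adj v u) ->
  num_prism_matchings S = num_prism_matchings (S :\ v).
Proof.
move=> vS isov; rewrite /num_prism_matchings.
rewrite (@num_matchings_of_expand G _ (o0, v)) ?inE //.
rewrite (big_pred1 (o1, v)) ?columnsD1 // => -[x u].
rewrite !inE /= /cart_adj /= xpair_eqE.
case: (boolP (u \in S)) => [uS|uS] /=.
  rewrite (negPf (isov u uS)) andbF.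
    by case: (path2P x) => ->; rewrite ?andbF ?andbT //= eq_sym.
by case: (eqVneq u v) uS => [->|_ _]; rewrite ?vS ?andbF.
Qed.

Lemma num_prism_matchings_leaf S (v w : H) :
  v \in S -> w \in S -> (forall u, u \in S -> adj v u = (u == w)) ->
  num_prism_matchings S =
  num_prism_matchings (S :\ v) + num_prism_matchings (S :\ v :\ w).
Proof.
move=> vS wS leafv; rewrite /num_prism_matchings.
rewrite (@num_matchings_of_expand G _ (o0, v)) ?inE //.
(* The possible partners of [(o0, v)] are its twin [(o1, v)] and [(o0, w)]; the twin is split off
   first. *)
rewrite (bigD1 (o1, v)) /=; last by rewrite inE /= vS /cart_adj /= eqxx.
rewrite columnsD1; congr (_ + _).
rewrite (big_pred1 (o0, w)); last first.
  move=> -[x u]; rewrite !inE /= /cart_adj /= !xpair_eqE.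
  case: (boolP (u \in S)) => [uS|uS] /=.
    rewrite leafv // (eq_sym v u); case: (path2P x) => -> /=.
      by rewrite andbF orbF andbT.
    by rewrite andbT andbN.
  by case: (eqVneq u w) uS => [->|_ _]; rewrite ?wS ?andbF.
(* With [(o0, v)] and [(o0, w)] gone, [(o1, v)] has lost its twin and must go with [(o1, w)]; this
   empties both columns. *)
rewrite (@num_matchings_of_expand G _ (o1, v)); last first.
  by rewrite !inE /= vS.
rewrite (big_pred1 (o1, w)) => [|[x u]]; last first.
  rewrite !inE /= /cart_adj /= !xpair_eqE.
  case: (boolP (u \in S)) => [uS|uS] /=.
    rewrite leafv // (eq_sym v u); case: (path2P x) => -> /=.
      by case: (u == v); rewrite ?andbF.
    by rewrite andbF orbF.
  by case: (eqVneq u w) uS => [->|_ _]; rewrite ?wS ?andbF.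
congr num_matchings_of; apply/setP => -[x u]; rewrite !inE /= !xpair_eqE.
by case: (path2P x) => -> /=; case: (u == v); case: (u == w); rewrite ?andbF.
Qed.

End Prism.

(** * Initial segments of the caterpillar *)

Section CaterpillarPrism.
Variable n : nat.

(** Ordinals start at 0, so these are the labels from 1 to [k]. For [3 <= k <= n] they induce the
    caterpillar on [k] vertices, and for [k = 2] two isolated vertices. *)
Definition initial (k : nat) : {set caterpillar n} :=
  [set i : caterpillar n | (i : 'I_n) < k].

Lemma initialD1 k (v : caterpillar n) :
  (v : 'I_n) = k :> nat -> initial k.+1 :\ v = initial k.
Proof.
move=> vk; apply/setP => i; rewrite !inE -(inj_eq val_inj) /= vk ltnS.
by rewrite [RHS]ltn_neqAle.
Qed.

Lemma num_prism_matchings_star : 3 <= n ->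
  num_prism_matchings (initial 2) = 1 /\ num_prism_matchings (initial 3) = 3.
Proof.
move=> n3.
pose v0 : caterpillar n := Ordinal (ltn_trans (isT : 0 < 2) n3).
pose v1 : caterpillar n := Ordinal (ltn_trans (isT : 1 < 2) n3).
pose v2 : caterpillar n := Ordinal n3.
have single (v : caterpillar n) : num_prism_matchings [set v] = 1.
  rewrite (@num_prism_matchings_isolated _ _ v) ?set11 //.
    by rewrite setDv num_prism_matchings0.
  by move=> u /set1P ->; rewrite adj_irrefl.
have E2 : initial 2 :\ v0 = [set v1].
  by apply/setP => -[[|[|i]] lt_i]; rewrite !inE -!(inj_eq val_inj).
have E3 : initial 3 :\ v0 = [set v1; v2].
  by apply/setP => -[[|[|[|i]]] lt_i]; rewrite !inE -!(inj_eq val_inj).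
have E3' : initial 3 :\ v0 :\ v2 = [set v1].
  by apply/setP => -[[|[|[|i]]] lt_i]; rewrite !inE -!(inj_eq val_inj).
have E12 : [set v1; v2] :\ v1 = [set v2].
  by apply/setP => -[[|[|[|i]]] lt_i]; rewrite !inE -!(inj_eq val_inj).
split.
  rewrite (@num_prism_matchings_isolated _ _ v0) ?inE ?E2 ?single //.
  by case=> [[|[|i]] lt_i]; rewrite inE.
(* Labels 1, 2, 3 form a path with centre 3. Stripping leaf 1 leaves the edge between 2 and 3, whose
   prism has 1 + 1 matchings, or the single vertex 2, with one. *)
rewrite (@num_prism_matchings_leaf _ _ v0 v2) ?inE //; last first.
  by case=> [[|[|[|i]]] lt_i]; rewrite inE.
rewrite E3' E3 single (@num_prism_matchings_leaf _ _ v1 v2) ?set21 ?set22 //.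
  by rewrite E12 setDv single num_prism_matchings0.
by move=> u /set2P[] ->.
Qed.

(** The last vertex has label [k.+2], at least 4, so its only neighbour in the segment is label
    [k.+1]. For [k = 1] it would be the centre 3, which has two neighbours there. *)
Lemma num_prism_matchings_initial_rec k : 2 <= k -> k.+2 <= n ->
  num_prism_matchings (initial k.+2) =
  num_prism_matchings (initial k.+1) + num_prism_matchings (initial k).
Proof.
move=> k2 kn.
pose v : caterpillar n := Ordinal kn.
pose w : caterpillar n := Ordinal (ltnW kn).
rewrite (@num_prism_matchings_leaf _ _ v w) ?inE //=.
- by rewrite !initialD1.
- move=> u; rewrite inE -(inj_eq val_inj) /= => uk.
  rewrite /caterpillar_adj /caterpillar_edge /= !eqSS.
  case: u uk => u lt_u /= uk.
  case: k k2 {kn v w} uk => [|[|k]] // _ uk.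
  rewrite !eqSS /= (ltn_eqF uk) ?andbF /= (eq_sym k.+2).
  by case: u uk {lt_u} => [|[|u]].
Qed.

(** The claim starts at two isolated vertices rather than at three labels, so that the values 1 and
    3 serve as the two base cases of the recurrence. *)
Lemma num_prism_matchings_initial k : 3 <= n -> k.+2 <= n ->
  num_prism_matchings (initial k.+2) = lucas k.+1.
Proof.
move=> n3; have [N2 N3] := num_prism_matchings_star n3.
elim/ltn_ind: k => -[|[|k]] // IH kn.
rewrite num_prism_matchings_initial_rec // !IH //; do ?exact: ltnW.
exact: ltnW (ltnW kn).
Qed.

End CaterpillarPrism.

Theorem theorem5p9 (n : nat) (hn : 3 <= n) :
  lucas (n - 1) = num_perfect_matchings (cart_prod (path_graph 2) (caterpillar n)).
Proof.
rewrite -num_prism_matchingsT.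
have -> : setT = initial n n by apply/setP => i; rewrite !inE ltn_ord.
case: n hn => [|[|n]] // hn.
by rewrite num_prism_matchings_initial // subn1.
Qed.
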